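(* Let $\mathfrak{P}_2$ be the set of all $2$-variate probability distributions $\bar p=\{p_{i_1i_2}\}_{(i_1,i_2)\in\mathbb{N}_0^2}$ and put $$L_{H(X_1|X_2)}(\bar p|\varepsilon)=\inf\left\{H(X_1|X_2)_{\bar q}\,:\,\bar q\in\mathfrak{P}_2,\ \mathrm{TV}(\bar p,\bar q)\le\varepsilon\right\}.$$ Let $\widetilde H(X_1|X_2)$ be the homogeneous extension of the Shannon conditional entropy $H(X_1|X_2)$ to the cone of (summable) $2$-variate arrays of nonnegative numbers. A) If $\bar p$ is an arbitrary probability distribution in $\mathfrak{P}_2$ then $$L_{H(X_1|X_2)}(\bar p|\varepsilon)\ge\widetilde H(X_1|X_2)_{[\bar p-\varepsilon]_+}-g(\varepsilon)\qquad\forall\varepsilon\in(0,1].\qquad\text{(i)}$$ B) If $\bar p\in\mathfrak{P}_2$ is such that $H(X_1|X_2)_{\bar p}<+\infty$ then $$L_{H(X_1|X_2)}(\bar p|\varepsilon)\ge H(X_1|X_2)_{\bar p}-\widetilde H(X_1|X_2)_{\bar p\wedge\varepsilon}-g(\varepsilon)\qquad\forall\varepsilon\in(0,1].\qquad\text{(ii)}$$ The lower bounds (i) and (ii) are faithful: their right hand sides tend to $H(X_1|X_2)_{\bar p}\le+\infty$ as $\varepsilon\to0$.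
   Context: $\mathbb{N}_0$ is the set of nonnegative integers. $\mathrm{TV}(\bar p,\bar q)=\frac12\sum_{i_1,i_2}|p_{i_1i_2}-q_{i_1i_2}|$. The Shannon conditional entropy (equivocation) of random variables $X_1,X_2$ with joint distribution $\bar p$ is $$H(X_1|X_2)_{\bar p}=\sum_{i_1,i_2}p_{i_1i_2}\left(-\ln\frac{p_{i_1i_2}}{[\bar p_2]_{i_2}}\right)\in[0,+\infty],\qquad[\bar p_2]_{i_2}=\sum_{i_1}p_{i_1i_2}$$ (terms with $p_{i_1i_2}=0$ are zero). Its homogeneous extension is $\widetilde H(X_1|X_2)_{\bar p}=\|\bar p\|_1H(X_1|X_2)_{\bar p/\|\bar p\|_1}$, $\|\bar p\|_1=\sum_{i_1,i_2}p_{i_1i_2}$, for nonzero arrays, and $0$ at the zero array. $\bar p\wedge\varepsilon=\{\min\{p_{i_1i_2},\varepsilon\}\}$, $[\bar p-\varepsilon]_+=\{\max\{p_{i_1i_2}-\varepsilon,0\}\}$. $g(x)=(x+1)\ln(x+1)-x\ln x$ for $x>0$, $g(0)=0$. *)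

(* Defs.v *)
From HB Require Import structures.
From mathcomp Require Import all_boot all_order all_algebra.
From mathcomp Require Import all_classical all_reals all_analysis.

Set Implicit Arguments.
Unset Strict Implicit.
Unset Printing Implicit Defensive.

Import Order.TTheory GRing.Theory Num.Theory.
Import numFieldNormedType.Exports.

Local Open Scope classical_set_scope.
Local Open Scope ring_scope.
Local Open Scope ereal_scope.

(** Entries are indexed as [p (i1, i2)], the first component being the value of
    X1 and the second one the value of X2. *)
Definition array2 (R : realType) := nat * nat -> R.

Definition distr2 (R : realType) : set (array2 R) :=
  [set p | (forall i, (0 <= p i)%R) /\ \esum_(i in [set: nat * nat]) (p i)%:E = 1].

Definition TV (R : realType) (p q : array2 R) : \bar R :=
  (2^-1)%:E * \esum_(i in [set: nat * nat]) (`|p i - q i|%R)%:E.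

Definition marginal2 (R : realType) (p : array2 R) (i2 : nat) : R :=
  fine (\esum_(i1 in [set: nat]) (p (i1, i2))%:E).

(** The terms with [p i = 0] vanish, and the other ones are nonnegative when [p]
    is a distribution, so the sum makes sense in [0, +oo]. *)
Definition condH (R : realType) (p : array2 R) : \bar R :=
  \esum_(i in [set: nat * nat]) (p i * - ln (p i / marginal2 p i.2))%:E.

(** Meaningful for summable arrays of nonnegative numbers. *)
Definition norm1 (R : realType) (p : array2 R) : R :=
  fine (\esum_(i in [set: nat * nat]) (p i)%:E).

Definition hcondH (R : realType) (p : array2 R) : \bar R :=
  if `[< forall i, p i = 0%R >] then 0
  else (norm1 p)%:E * condH (fun i => (p i / norm1 p)%R).

Definition arr_min (R : realType) (p : array2 R) (eps : R) : array2 R :=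
  fun i => Num.min (p i) eps.

Definition arr_subpos (R : realType) (p : array2 R) (eps : R) : array2 R :=
  fun i => Num.max (p i - eps)%R 0%R.

(** [g 0 = 0] because [0 * ln 0 = 0] whatever the value of [ln 0]. *)
Definition g (R : realType) (x : R) : R :=
  ((x + 1) * ln (x + 1) - x * ln x)%R.

Definition LcondH (R : realType) (p : array2 R) (eps : R) : \bar R :=
  ereal_inf [set condH q | q in [set q | distr2 q /\ TV p q <= eps%:E]].

(* Main.v *)
(** Write [F p] for the sum of the terms [p i * - ln (p i / marginal2 p i.2)] of
    an arbitrary summable nonnegative array; it is homogeneous, so it is the
    homogeneous extension of the conditional entropy. By the log-sum inequality
    [F] is superadditive, hence monotone for the entrywise order, and
    [F (a + b) <= F a + F b - |a| ln A - |b| ln B] whenever [A + B = 1].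

    If [TV p q <= e] and [m = min (p, q)], then [r = p - m] has mass at most
    [e]; hence [[p - e]_+ <= q] entrywise, which gives (i) by monotonicity.
    Moreover [m <= q] and [r <= min (p, e)], and the almost-subadditivity of
    [F] at [p = m + r] with [A = 1 / (1 + e)], [B = e / (1 + e)] gives (ii).

    [F [p - e]_+] tends to [F p] by a Fatou argument and monotonicity, and the
    limit of (ii) follows by squeezing since superadditivity gives
    [F [p - e]_+ <= F p - F (min (p, e)) <= F p]. *)
Require Import Defs.
From HB Require Import structures.
From mathcomp Require Import all_boot all_order all_algebra.
From mathcomp Require Import all_classical all_reals all_analysis.
From mathcomp Require Import ring lra.

Import Order.TTheory GRing.Theory Num.Theory.
Import numFieldNormedType.Exports.

Local Open Scope classical_set_scope.
Local Open Scope ring_scope.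
Local Open Scope ereal_scope.

(** * Scalar inequalities for one entropy term, and the size of [g] near zero *)

Section real_inequalities.
Context {R : realType}.
Implicit Types x y z s t w A : R.
Local Open Scope ring_scope.

Lemma ln_le_sub1 x : 0 < x -> ln x <= x - 1.
Proof.
by move=> x0; have := @le_ln1Dx R (x - 1); rewrite [1 + _]addrC subrK; apply; lra.
Qed.

(** The summand of [condH] for an entry [x] in a column of mass [s]. *)
Definition ent x s : R := x * - ln (x / s).

Lemma ent0 s : ent 0 s = 0. Proof. by rewrite /ent mul0r. Qed.

Lemma ent_pos x s : 0 < x -> 0 < s -> ent x s = x * (ln s - ln x).
Proof. by move=> x0 s0; rewrite /ent ln_div ?posrE// opprB. Qed.

Lemma ent_ge0 x s : 0 <= x -> x <= s -> 0 <= ent x s.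
Proof.
rewrite le_eqVlt => /predU1P[<-|x0 xs]; first by rewrite ent0.
have s0 := lt_le_trans x0 xs.
by rewrite ent_pos// mulr_ge0 ?(ltW x0)// subr_ge0 ler_ln.
Qed.

Lemma ent_le x s t : 0 <= x -> x <= s -> s <= t -> ent x s <= ent x t.
Proof.
rewrite le_eqVlt => /predU1P[<-|x0 xs st]; first by rewrite !ent0.
have s0 := lt_le_trans x0 xs; have t0 := lt_le_trans s0 st.
by rewrite !ent_pos// ler_pM2l// lerB// ler_ln.
Qed.

(* [ln u <= u - 1] at [u = s * (x + y) / (x * (s + t))], and symmetrically. *)
Lemma ent_superadd x y s t : 0 <= x -> x <= s -> 0 <= y -> y <= t ->
  ent x s + ent y t <= ent (x + y) (s + t).
Proof.
move=> x0 xs y0 yt.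
move: (x0); rewrite le_eqVlt => /predU1P[<-|xp].
  by rewrite ent0 !add0r ent_le//; lra.
move: (y0); rewrite le_eqVlt => /predU1P[<-|yp].
  by rewrite ent0 !addr0 ent_le//; lra.
have sp := lt_le_trans xp xs; have tp := lt_le_trans yp yt.
have key (a b : R) : 0 < a -> 0 < b ->
    a * (ln b + ln (x + y) - ln a - ln (s + t)) <= b * (x + y) / (s + t) - a.
  move=> a0 b0; rewrite [leRHS](_ : _ = a * (b * (x + y) / (a * (s + t)) - 1));
    last first.
    by field; lra.
  rewrite ler_pM2l//.
  have -> : ln b + ln (x + y) - ln a - ln (s + t) =
      ln (b * (x + y) / (a * (s + t))).
    have ? : 0 < x + y by exact: addr_gt0.
    have ? : 0 < s + t by exact: addr_gt0.
    by rewrite ln_div ?lnM ?posrE ?mulr_gt0//; ring.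
  by apply: ln_le_sub1; rewrite divr_gt0 ?mulr_gt0 ?addr_gt0.
rewrite !ent_pos ?addr_gt0//.
(* The right-hand sides of these two instances add up to zero, by the identity that follows. *)
have := key _ _ xp sp; have := key _ _ yp tp.
have : s * (x + y) / (s + t) + t * (x + y) / (s + t) = x + y.
  by field; lra.
nra.
Qed.

(* [ln u <= u - 1] at [u = A * w / s]. *)
Lemma ent_subadd_half x z s w A : 0 <= x -> x <= s -> x <= z -> 0 < A ->
  s <= w ->
  x * - ln (z / w) + x <= ent x s + x * - ln A + A * (x * (w / s)).
Proof.
rewrite le_eqVlt => /predU1P[<-|x0 xs xz A0 sw];
  first by rewrite ent0 !mul0r !mulr0 !addr0.
have s0 := lt_le_trans x0 xs; have w0 := lt_le_trans s0 sw.
have z0 := lt_le_trans x0 xz.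
rewrite ent_pos// ln_div ?posrE//.
have lxz : ln x <= ln z by rewrite ler_ln.
have As : 0 < A * (w / s) by rewrite mulr_gt0// divr_gt0.
have := ln_le_sub1 _ As; rewrite lnM ?posrE ?divr_gt0// ln_div ?posrE// => h.
rewrite (_ : A * (x * (w / s)) = x * (A * (w / s))); last by ring.
nra.
Qed.

(** Two instances of [ent_subadd_half] with [z = x + y] and [w = s + t]. The extra [x + y] on the
    left is kept so that, after summation over all entries, it absorbs the last two terms. *)
Lemma ent_subadd x y s t A B : 0 <= x -> x <= s -> 0 <= y -> y <= t ->
    0 < A -> 0 < B ->
  ent (x + y) (s + t) + (x + y) <= ent x s + ent y t + (x * - ln A + y * - ln B)
    + (A * (x * ((s + t) / s)) + B * (y * ((s + t) / t))).
Proof.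
move=> x0 xs y0 yt A0 B0.
have := @ent_subadd_half x (x + y) s (s + t) A x0 xs _ A0 _.
have := @ent_subadd_half y (x + y) t (s + t) B y0 yt _ B0 _.
by rewrite /ent; lra.
Qed.

Lemma g_ge0 x : 0 <= x -> x <= 1 -> 0 <= g x.
Proof.
move=> x0 x1; rewrite /g.
have := @ln_le0 R x x1; have := @ln_ge0 R (x + 1).
by nra.
Qed.

(** The singular part is controlled by [ln u <= u - 1] at [u = 1 / sqrt x], because [- ln x] is
    twice [ln u]. The resulting majorant is continuous and vanishes at zero. *)
Lemma g_le_sqrt x : 0 < x -> g x <= (x + 1) * x + 2 * Num.sqrt x.
Proof.
move=> x0; rewrite /g; have s0 : 0 < Num.sqrt x by rewrite sqrtr_gt0.
have sx : Num.sqrt x ^+ 2 = x by rewrite sqr_sqrtr ?ltW.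
have l1 : ln (x + 1) <= x by have := ln_le_sub1 (x + 1); lra.
have Vs : 0 < (Num.sqrt x)^-1 by rewrite invr_gt0.
have := ln_le_sub1 _ Vs; rewrite lnV ?posrE// => l2.
have lx : ln x = 2 * ln (Num.sqrt x) by rewrite -{1}sx lnXn// mulr_natl.
have l3 : x * - ln (Num.sqrt x) <= Num.sqrt x.
  apply: (@le_trans _ _ (x * (Num.sqrt x)^-1)).
    by rewrite ler_pM2l//; lra.
  by rewrite -{1}sx expr2 mulfK// gt_eqF.
rewrite lx; nra.
Qed.

Lemma cvg_g0 : (@g R) x @[x --> 0^'+] --> 0.
Proof.
apply: (@squeeze_cvgr _ _ _ _ (cst 0)
  (fun x : R => (x + 1) * x + 2 * Num.sqrt x)).
- near=> x.
  have x0 : 0 < x by [].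
  rewrite g_ge0 ?g_le_sqrt//= ?ltW//.
- exact: cvg_cst.
- rewrite [X in _ --> X](_ : 0 = (0 + 1) * 0 + 2 * Num.sqrt (0:R)); last first.
    by rewrite sqrtr0; ring.
  apply: cvgD.
    by apply: cvgM; [apply: cvgD; [|exact: cvg_cst]|];
      apply: cvg_at_right_filter; exact: cvg_id.
  apply: cvgM; first exact: cvg_cst.
  apply: cvg_at_right_filter; exact: sqrt_continuous.
Unshelve. all: by end_near. Qed.

End real_inequalities.

(** * Sums of nonnegative families: scaling, iterated sums, limits *)

Section esum_extra.
Context {R : realType}.

Lemma esum_ge_term (T : choiceType) (D : set T) (a : T -> \bar R) (i : T) :
  D i -> a i <= \esum_(j in D) a j.
Proof.
move=> Di; apply: esum_ge; exists [set i]; last by rewrite fsbig_set1.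
by split=> // j ->.
Qed.

(** One inequality, [le_scale], holds for every scalar; applied to the inverse of [c] it yields the
    converse. *)
Lemma esumZ (T : choiceType) (a : T -> \bar R) (c : R) :
  (0 <= c)%R -> (forall i, 0 <= a i) ->
  \esum_(i in [set: T]) (c%:E * a i) = c%:E * \esum_(i in [set: T]) a i.
Proof.
have le_scale (b : T -> \bar R) (d : R) : (0 <= d)%R -> (forall i, 0 <= b i) ->
    \esum_(i in [set: T]) (d%:E * b i) <= d%:E * \esum_(i in [set: T]) b i.
  move=> d0 b0; apply: ge_ereal_sup => _ [X XD <-].
  by rewrite -ge0_mule_fsumr// lee_wpmul2l// esum_ge//; exists X.
rewrite le_eqVlt => /predU1P[<- a0|c0 a0].
  by rewrite mul0e esum1// => i _; rewrite mul0e.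
apply/eqP; rewrite eq_le le_scale ?(ltW c0)//=.
rewrite -lee_pdivlMl//; apply: le_trans (le_scale _ _ _ _).
- by apply: le_esum => i _; rewrite muleA -EFinM mulVf ?mul1e// gt_eqF.
- by rewrite invr_ge0 ltW.
- by move=> i; rewrite mule_ge0// lee_fin ltW.
Qed.

(** The outer sum runs over the second index, so that the inner sums are the column masses recorded
    by [marginal2]. *)
Lemma esum_prod_swap (T1 T2 : choiceType) (f : T1 * T2 -> \bar R) :
  (forall i, 0 <= f i) ->
  \esum_(i in [set: T1 * T2]) f i =
  \esum_(j in [set: T2]) \esum_(i in [set: T1]) f (i, j).
Proof.
move=> f0; rewrite esum_esum//.
rewrite (reindex_esum ([set: T2] `*`` (fun=> [set: T1])) [set: T1 * T2]
  (fun k => (k.2, k.1)))//.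
split=> //; first by move=> [a b] [c d] _ _ /= [-> ->].
by move=> [a b] _; exists (b, a).
Qed.

(** Testing against real [c] below [l] treats a finite and an infinite limit uniformly; the upper
    half of the convergence is the assumed bound by [l]. *)
Lemma cvge_of_lower_bounds (T : Type) (F : set_system T) (FF : ProperFilter F)
  (f : T -> \bar R) (l : \bar R) :
  (\forall x \near F, 0 <= f x <= l) ->
  (forall c : R, c%:E < l -> \forall x \near F, c%:E < f x) ->
  f @ F --> l.
Proof.
move=> fl lf; case: (eqVneq l +oo) => [ly|lNy].
  by rewrite ly; apply/cvgeyPgt => A; apply: lf; rewrite ly ltry.
have [x0 /andP[l0 l0']] := filter_ex fl.
have lfin : l \is a fin_num by rewrite ge0_fin_numE ?ltey// (le_trans l0).
have lE := fineK lfin.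
have ffin : \forall x \near F, f x \is a fin_num.
  near=> x.
  have /andP[fx0 fxl] : 0 <= f x <= l by near: x.
  by rewrite ge0_fin_numE// (le_lt_trans fxl)// ltey.
rewrite -lE; apply/fine_cvgP; split => //.
apply/cvgrPdist_lt => e e0; near=> x => /=.
have /andP[fx0 fxl] : 0 <= f x <= l by near: x.
have fxfin : f x \is a fin_num by near: x.
have : (fine l - e)%:E < f x.
  near: x; apply: lf; rewrite -[ltRHS]lE lte_fin; lra.
move: fxl; rewrite -(fineK fxfin) -lE !lte_fin !lee_fin /= => h1 h2.
by rewrite ger0_norm; lra.
Unshelve. all: by end_near. Qed.

(** Fatou's argument: a finite partial sum of [v] above [c] is the limit of partial sums of [u x],
    which bound the full sums from below. Domination is required of the totals only, which is what
    [condH_le] provides. *)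
Lemma cvg_esum_dominated (T : Type) (F : set_system T) (FF : ProperFilter F)
    (I : choiceType) (u : T -> I -> R) (v : I -> R) :
  (\forall x \near F, forall i, (0 <= u x i)%R) ->
  (forall i, u x i @[x --> F] --> v i) ->
  (\forall x \near F, \esum_(i in [set: I]) (u x i)%:E <=
    \esum_(i in [set: I]) (v i)%:E) ->
  \esum_(i in [set: I]) (u x i)%:E @[x --> F] -->
    \esum_(i in [set: I]) (v i)%:E.
Proof.
move=> u0 uv le_uv; apply: cvge_of_lower_bounds.
  near=> x; apply/andP; split; last by near: x.
  have ux : forall i, (0 <= u x i)%R by near: x.
  by apply: esum_ge0 => i _; rewrite lee_fin.
move=> c /ereal_sup_gt[_ [X [finX _] <-]];
  rewrite fsbig_finite//= sumEFin lte_fin => cX.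
have uX : (\sum_(i <- finmap.enum_fset (fset_set X)) u x i)%R @[x --> F]
    --> (\sum_(i <- finmap.enum_fset (fset_set X)) v i)%R.
  elim: (finmap.enum_fset _) => [|i s IHs].
    by rewrite big_nil; under eq_fun do rewrite big_nil; exact: cvg_cst.
  by rewrite big_cons; under eq_fun do rewrite big_cons; exact: cvgD.
near=> x.
have ux : forall i, (0 <= u x i)%R by near: x.
apply: (@lt_le_trans _ _ (\sum_(i \in X) (u x i)%:E));
  last by apply: esum_ge; exists X.
rewrite fsbig_finite//= sumEFin lte_fin.
by near: x; apply: (cvgr_gt _ uX).
Unshelve. all: by end_near. Qed.

End esum_extra.

(** * Conditional entropy on the cone of summable arrays *)

Section arrays.
Context {R : realType}.
Implicit Types p q a b : array2 R.

(** On this cone the sums under [fine] in [norm1] and [marginal2] are finite, so no default value of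
    [fine] intervenes. *)
Definition summable2 p :=
  (forall i, (0 <= p i)%R) /\ \esum_(i in [set: nat * nat]) (p i)%:E < +oo.

Lemma distr2_summable2 p : distr2 p -> summable2 p.
Proof. by move=> [p0 p1]; split; rewrite ?p1 ?ltry. Qed.

Lemma le_summable2 p q : (forall i, (0 <= p i <= q i)%R) -> summable2 q ->
  summable2 p.
Proof.
move=> pq [q0 qoo]; split=> [i|]; first by case/andP: (pq i).
by apply: le_lt_trans qoo; apply: le_esum => i _; rewrite lee_fin;
  case/andP: (pq i).
Qed.

Lemma norm1E p : summable2 p ->
  (norm1 p)%:E = \esum_(i in [set: nat * nat]) (p i)%:E.
Proof.
by move=> [p0 poo]; rewrite fineK// ge0_fin_numE//; apply: esum_ge0 => i _;
  rewrite lee_fin.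
Qed.

Lemma marginal2E p j : summable2 p ->
  (marginal2 p j)%:E = \esum_(i in [set: nat]) (p (i, j))%:E.
Proof.
move=> [p0 poo]; rewrite fineK// ge0_fin_numE; last first.
  by apply: esum_ge0 => i _; rewrite lee_fin.
apply: le_lt_trans poo; rewrite esum_prod_swap;
  last by move=> i; rewrite lee_fin.
exact: (@esum_ge_term _ _ _ (fun j => \esum_(i in [set: nat]) (p (i, j))%:E)).
Qed.

Lemma le_marginal2_entry p i : summable2 p -> (p i <= marginal2 p i.2)%R.
Proof.
move=> sp; rewrite -lee_fin marginal2E//; case: i => i j.
exact: (@esum_ge_term _ _ _ (fun i => (p (i, j))%:E)).
Qed.

Lemma marginal2_ge0 p j : summable2 p -> (0 <= marginal2 p j)%R.
Proof. by move=> sp; apply: le_trans (le_marginal2_entry p (0%N, j) sp);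
  apply sp.1. Qed.

Lemma marginal2D a b j : summable2 a -> summable2 b ->
  marginal2 (a \+ b)%R j = (marginal2 a j + marginal2 b j)%R.
Proof.
move=> sa sb; rewrite {1}/marginal2.
under eq_esum do rewrite EFinD.
rewrite esumD -?marginal2E//= => i _; rewrite lee_fin;
  [exact: sa.1|exact: sb.1].
Qed.

Lemma marginal2Z a (c : R) j : summable2 a -> (0 <= c)%R ->
  marginal2 (fun i => (c * a i)%R) j = (c * marginal2 a j)%R.
Proof.
move=> sa c0; rewrite {1}/marginal2.
under eq_esum do rewrite EFinM.
by rewrite esumZ// -?marginal2E// => i; rewrite lee_fin sa.1.
Qed.

Lemma condH_ent_ge0 p i : summable2 p -> 0 <= (ent (p i) (marginal2 p i.2))%:E.
Proof. by move=> sp; rewrite lee_fin ent_ge0 ?le_marginal2_entry// sp.1. Qed.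

Lemma condH_ge0 p : summable2 p -> 0 <= condH p.
Proof. by move=> sp; apply: esum_ge0 => i _; exact: condH_ent_ge0. Qed.

(** Normalising leaves each ratio of an entry to its column mass unchanged, and the factor [norm1 p]
    cancels. The later estimates can thus be stated for [condH] alone. *)
Lemma hcondHE p : summable2 p -> hcondH p = condH p.
Proof.
move=> sp; rewrite /hcondH; case: asboolP => [p0|pn0].
  by rewrite /condH esum1// => i _; rewrite p0 mul0r.
have n0 : (0 < norm1 p)%R.
  rewrite lt_neqAle -(lee_fin 0) norm1E// esum_ge0 ?andbT; last first.
    by move=> i _; rewrite lee_fin sp.1.
  apply/eqP => /esym np0; apply: pn0 => i.
  apply/eqP; rewrite eq_le sp.1 andbT -np0 -lee_fin norm1E//.
  exact: (@esum_ge_term _ _ _ (fun i => (p i)%:E)).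
have V0 : (0 <= (norm1 p)^-1)%R by rewrite invr_ge0 ltW.
rewrite (_ : (fun i => p i / norm1 p)%R = (fun i => (norm1 p)^-1 * p i)%R);
  last first.
  by apply/funext => k; rewrite mulrC.
set q := fun i => _; have sq : summable2 q.
  split=> [k|]; first by rewrite mulr_ge0// sp.1.
  under eq_esum do rewrite EFinM.
  rewrite esumZ//; last by move=> k; rewrite lee_fin sp.1.
  by rewrite -norm1E// -EFinM ltry.
rewrite -esumZ ?ltW//; last by move=> i; exact: condH_ent_ge0.
apply: eq_esum => i _; rewrite -EFinM marginal2Z//.
rewrite -mulf_div divff ?mul1r; last by rewrite invr_neq0// gt_eqF.
by rewrite mulrA mulVKf// gt_eqF.
Qed.

(** Marginals are additive, so [ent_superadd] applies entry by entry. *)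
Lemma condH_superadd a b : summable2 a -> summable2 b ->
  condH a + condH b <= condH (a \+ b)%R.
Proof.
move=> sa sb; rewrite /condH -esumD; first last.
- by move=> i _; exact: condH_ent_ge0.
- by move=> i _; exact: condH_ent_ge0.
apply: le_esum => i _; rewrite marginal2D// -EFinD lee_fin.
by apply: ent_superadd; rewrite ?le_marginal2_entry// ?sa.1 ?sb.1.
Qed.

(** Superadditivity for [b = a + (b - a)], where the entropy of the difference is nonnegative. *)
Lemma condH_le a b : (forall i, (0 <= a i <= b i)%R) -> summable2 b ->
  condH a <= condH b.
Proof.
move=> ab sb; have sa := le_summable2 _ _ ab sb.
have sba : summable2 (b \- a)%R.
  apply: (le_summable2 _ _ _ sb) => i; rewrite subr_ge0 gerBl;
    case/andP: (ab i) => *; exact/andP.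
have -> : b = (a \+ (b \- a))%R by apply/funext => i /=; rewrite addrC subrK.
by apply: le_trans (condH_superadd _ _ sa sba); rewrite leeDl// condH_ge0.
Qed.

(** Column [j] of [p] is rescaled to mass [w j]. A column of mass zero stays zero, whence an
    inequality only. *)
Lemma esum_entry_rescaled p (w : nat -> R) : summable2 p ->
  (forall j, 0 <= w j)%R ->
  \esum_(i in [set: nat * nat]) (p i * (w i.2 / marginal2 p i.2))%:E <=
  \esum_(j in [set: nat]) (w j)%:E.
Proof.
move=> sp w0.
have q0 j : (0 <= w j / marginal2 p j)%R by rewrite divr_ge0// marginal2_ge0.
rewrite esum_prod_swap; last by move=> i; rewrite lee_fin mulr_ge0 ?sp.1.
apply: le_esum => j _ /=.
under eq_esum do rewrite mulrC EFinM.
rewrite esumZ//; last by move=> i; rewrite lee_fin sp.1.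
rewrite -marginal2E// -EFinM lee_fin.
have [->|s0] := eqVneq (marginal2 p j) 0%R; first by rewrite mulr0.
by rewrite divfK.
Qed.

Lemma esum_marginal2 p : summable2 p ->
  \esum_(j in [set: nat]) (marginal2 p j)%:E = (norm1 p)%:E.
Proof.
move=> sp; rewrite norm1E// esum_prod_swap;
  last by move=> i; rewrite lee_fin sp.1.
by apply: eq_esum => j _; rewrite marginal2E.
Qed.

Lemma summable2D a b : summable2 a -> summable2 b -> summable2 (a \+ b)%R.
Proof.
move=> [a0 ay] [b0 bby]; split=> [i|]; first by rewrite addr_ge0.
under eq_esum do rewrite EFinD.
by rewrite esumD ?lte_add_pinfty// => i _; rewrite lee_fin.
Qed.

Lemma norm1D a b : summable2 a -> summable2 b ->
  norm1 (a \+ b)%R = (norm1 a + norm1 b)%R.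
Proof.
move=> sa sb; apply: EFin_inj; rewrite EFinD !norm1E//; last exact: summable2D.
under eq_esum do rewrite EFinD.
by rewrite esumD// => i _; rewrite lee_fin; [exact: sa.1|exact: sb.1].
Qed.

(** The best weights are proportional to the masses of [a] and [b], but they degenerate when one
    mass vanishes; free positive weights avoid that case. *)
Lemma condH_subadd a b (A B : R) : summable2 a -> summable2 b ->
    (0 < A)%R -> (0 < B)%R -> (A + B = 1)%R ->
  condH (a \+ b)%R <=
  condH a + condH b + (norm1 a * - ln A + norm1 b * - ln B)%:E.
Proof.
move=> sa sb A0 B0 AB; have sab := summable2D _ _ sa sb.
have lA : (0 <= - ln A)%R by rewrite oppr_ge0 ln_le0//; lra.
have lB : (0 <= - ln B)%R by rewrite oppr_ge0 ln_le0//; lra.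
pose w := marginal2 (a \+ b)%R.
have w0 j : (0 <= w j)%R by exact: marginal2_ge0.
(* [ra] and [rb] are the error terms of [ent_subadd]: [a] and [b] with their nonzero columns
   rescaled to the column masses of [a \+ b]. *)
pose ra i := (a i * (w i.2 / marginal2 a i.2))%R.
pose rb i := (b i * (w i.2 / marginal2 b i.2))%R.
have ra0 i : (0 <= ra i)%R by rewrite mulr_ge0 ?sa.1// divr_ge0// marginal2_ge0.
have rb0 i : (0 <= rb i)%R by rewrite mulr_ge0 ?sb.1// divr_ge0// marginal2_ge0.
have le_terms :
    \esum_(i in [set: nat * nat])
      ((ent ((a \+ b)%R i) (w i.2))%:E + ((a \+ b)%R i)%:E) <=
    \esum_(i in [set: nat * nat])
      ((ent (a i) (marginal2 a i.2))%:E + (ent (b i) (marginal2 b i.2))%:E +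
       ((- ln A)%:E * (a i)%:E + (- ln B)%:E * (b i)%:E) +
       (A%:E * (ra i)%:E + B%:E * (rb i)%:E)).
  apply: le_esum => i _; rewrite -!EFinM -!EFinD lee_fin /ra /rb /w
    marginal2D//=.
  have := @ent_subadd _ (a i) (b i) (marginal2 a i.2) (marginal2 b i.2) A B.
  by rewrite ![(_ * - ln _)%R]mulrC; apply => //;
    rewrite ?sa.1 ?sb.1 ?le_marginal2_entry.
have ea i := condH_ent_ge0 a i sa; have eb i := condH_ent_ge0 b i sb.
have a0 i : 0 <= (a i)%:E by rewrite lee_fin sa.1.
have b0 i : 0 <= (b i)%:E by rewrite lee_fin sb.1.
have ra0' i : 0 <= (ra i)%:E by rewrite lee_fin.
have rb0' i : 0 <= (rb i)%:E by rewrite lee_fin.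
have lA' (x : \bar R) : 0 <= x -> 0 <= (- ln A)%:E * x
  by move=> ?; rewrite mule_ge0.
have lB' (x : \bar R) : 0 <= x -> 0 <= (- ln B)%:E * x
  by move=> ?; rewrite mule_ge0.
have A' (x : \bar R) : 0 <= x -> 0 <= A%:E * x
  by move=> ?; rewrite mule_ge0// lee_fin ltW.
have B' (x : \bar R) : 0 <= x -> 0 <= B%:E * x
  by move=> ?; rewrite mule_ge0// lee_fin ltW.
move: le_terms.
rewrite esumD; [|by move=> i _; exact: condH_ent_ge0|by move=> i _;
  rewrite lee_fin sab.1].
rewrite -[X in X + _ <= _]/(condH (a \+ b)%R) -(norm1E _ sab).
rewrite !esumD; try by move=> i _; rewrite ?adde_ge0 ?lA' ?lB' ?A' ?B'.
rewrite !esumZ ?(ltW A0) ?(ltW B0)//.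
rewrite -(norm1E _ sa) -(norm1E _ sb) -[X in X + _ + _ + _]/(condH a)
  -[X in _ + X + _ + _]/(condH b).
(* The error terms of [ent_subadd] add up to at most the mass of [a \+ b],
   which also occurs on the left and cancels. *)
have sra := esum_entry_rescaled a w sa w0.
have srb := esum_entry_rescaled b w sb w0.
rewrite esum_marginal2// in sra; rewrite esum_marginal2// in srb.
move=> /le_trans/(_ (leeD (lexx _) (leeD (lee_wpmul2l _ sra) (lee_wpmul2l _
  srb)))).
rewrite !lee_fin (ltW A0) (ltW B0) -!EFinM -!EFinD -mulrDl AB mul1r =>
  /(_ isT isT).
by rewrite leeD2rE// ![(- ln _ * _)%R]mulrC.
Qed.

(** * Truncated arrays and total variation *)

Lemma summable2_subpos p (e : R) : (0 <= e)%R -> summable2 p ->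
  summable2 (arr_subpos p e).
Proof.
move=> e0 sp; apply: (le_summable2 _ _ _ sp) => i; have := sp.1 i.
by rewrite /arr_subpos le_max lexx orbT ge_max => ->; rewrite andbT gerBl.
Qed.

Lemma summable2_min p (e : R) : (0 <= e)%R -> summable2 p ->
  summable2 (arr_min p e).
Proof.
move=> e0 sp; apply: (le_summable2 _ _ _ sp) => i; have := sp.1 i.
by rewrite /arr_min le_min ge_min lexx e0 => ->.
Qed.

Lemma arr_subposD p (e : R) : (arr_subpos p e \+ arr_min p e)%R = p.
Proof.
apply/funext => i; rewrite /arr_subpos /arr_min /=.
by case: (leP (p i) e) => pe; rewrite /Num.max; case: ltP => ?; lra.
Qed.

(** With [m] the entrywise minimum, [p - m] and [q - m] have equal mass since [p] and [q] do, and
    they add up to the absolute difference; the factor one half in [TV] thus leaves one of the two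
    masses. *)
Lemma distr2_sub p q : distr2 p -> distr2 q ->
  \esum_(i in [set: nat * nat]) (p i - Num.min (p i) (q i))%:E = TV p q.
Proof.
move=> dp dq; have sp := distr2_summable2 _ dp;
  have sq := distr2_summable2 _ dq.
pose m i := Num.min (p i) (q i).
have sm : summable2 m.
  by apply: (le_summable2 _ _ _ sp) => i;
    rewrite /m le_min ge_min sp.1 sq.1 lexx.
have spm : summable2 (p \- m)%R.
  by apply: (le_summable2 _ _ _ sp) => i;
    rewrite /= subr_ge0 gerBl sm.1 /m ge_min lexx.
have sqm : summable2 (q \- m)%R.
  by apply: (le_summable2 _ _ _ sq) => i;
    rewrite /= subr_ge0 gerBl sm.1 /m ge_min lexx orbT.
have np : norm1 p = (norm1 m + norm1 (p \- m)%R)%R.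
  by rewrite -norm1D//; congr norm1; apply/funext => i /=; rewrite addrC subrK.
have nq : norm1 q = (norm1 m + norm1 (q \- m)%R)%R.
  by rewrite -norm1D//; congr norm1; apply/funext => i /=; rewrite addrC subrK.
have npq : norm1 p = norm1 q by apply: EFin_inj; rewrite !norm1E// dp.2 dq.2.
rewrite /TV -[LHS](norm1E _ spm).
rewrite (_ : \esum_(i in _) _ = (norm1 (p \- m)%R + norm1 (q \- m)%R)%:E).
  by rewrite -EFinM; congr EFin; lra.
rewrite EFinD !norm1E// -esumD.
- apply: eq_esum => i _; rewrite -EFinD /= /m; congr EFin.
  by case: (leP (p i) (q i)) => pq; [rewrite ler0_norm|rewrite gtr0_norm]; lra.
- by move=> i _; rewrite lee_fin; exact: spm.1.
- by move=> i _; rewrite lee_fin; exact: sqm.1.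
Qed.

Lemma TV_le_sub p q (e : R) i : distr2 p -> distr2 q -> TV p q <= e%:E ->
  (p i - Num.min (p i) (q i) <= e)%R.
Proof.
move=> dp dq pqe; rewrite -lee_fin; apply: le_trans pqe; rewrite -distr2_sub//.
exact: (@esum_ge_term _ _ _ (fun i => (p i - Num.min (p i) (q i))%:E)).
Qed.

Lemma condH_subpos_le_TV p q (e : R) : (0 <= e)%R -> distr2 p -> distr2 q ->
  TV p q <= e%:E ->
  condH (arr_subpos p e) <= condH q.
Proof.
move=> e0 dp dq pqe; apply: condH_le (distr2_summable2 _ dq) => i.
have := TV_le_sub _ _ _ i dp dq pqe;
  rewrite /arr_subpos le_max lexx orbT ge_max dq.1 andbT.
by case: (leP (p i) (q i)) => pq /=; lra.
Qed.

(** Bound (ii) for one competitor [q], in additive form so that no difference of infinite entropies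
    arises. *)
Lemma condH_min_le_TV p q (e : R) : (0 < e)%R -> (e <= 1)%R -> distr2 p ->
  distr2 q ->
  TV p q <= e%:E ->
  condH p <= condH q + condH (arr_min p e) + (g e)%:E.
Proof.
move=> e0 e1 dp dq pqe; have sp := distr2_summable2 _ dp;
  have sq := distr2_summable2 _ dq.
pose m i := Num.min (p i) (q i).
have mp i : (0 <= m i <= p i)%R by rewrite /m le_min ge_min sp.1 sq.1 lexx.
have mq i : (0 <= m i <= q i)%R by rewrite /m le_min ge_min sp.1 sq.1 lexx orbT.
have sm : summable2 m by apply: (le_summable2 _ _ _ sp).
(* The residual is below [p] because [m] is nonnegative, and below [e] because none of its entries
   exceeds its mass. *)
have rp i : (0 <= (p \- m)%R i <= arr_min p e i)%R.
  by rewrite /= subr_ge0 le_min gerBl (TV_le_sub _ _ _ _ dp dq pqe);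
    case/andP: (mp i) => -> ->.
have smin := summable2_min _ _ (ltW e0) sp.
have sr : summable2 (p \- m)%R by apply: (le_summable2 _ _ _ smin).
have pE : p = (m \+ (p \- m))%R by apply/funext => i /=; rewrite addrC subrK.
have V0 : (0 < (1 + e)^-1)%R by rewrite invr_gt0; lra.
rewrite {1}pE; apply: le_trans (condH_subadd _ _ ((1 + e)^-1) (e / (1 + e)) sm
  sr _ _ _) _.
- by [].
- by rewrite mulr_gt0.
- by field; lra.
rewrite leeD ?leeD ?condH_le// lee_fin.
have nm : (norm1 m <= 1)%R.
  rewrite -lee_fin norm1E// -dp.2; apply: le_esum => i _; rewrite lee_fin.
  by case/andP: (mp i).
have nr : (norm1 (p \- m)%R <= e)%R by rewrite -lee_fin norm1E// distr2_sub.
have nmr : (norm1 m + norm1 (p \- m)%R = 1)%R.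
  by rewrite -norm1D// -pE; apply: EFin_inj; rewrite norm1E// dp.2.
(* By [nmr] the error equals [ln (1 + e) - norm1 (p \- m) * ln e]. As [ln e <= 0], [nr] bounds it by
   [ln (1 + e) - e * ln e], which is at most [g e]. *)
rewrite lnM ?posrE// lnV ?posrE; last lra.
rewrite /g; have := @ln_le0 R e e1; have := @ln_ge0 R (1 + e);
  rewrite [(e + 1)%R]addrC.
nra.
Qed.

(** * Limits as the truncation level tends to zero *)

Lemma cvg_subpos_entry p i : (arr_subpos p e i @[e --> (0 : R)^'+] -->
  Num.max (p i) 0)%R.
Proof.
apply: cvg_at_right_filter; rewrite -[X in _ --> Num.max X _]subr0.
apply: (@continuous_max R R (fun e => p i - e)%R (cst 0%R) 0%R);
  last exact: cvg_cst.
by apply: cvgB; [exact: cvg_cst|exact: cvg_id].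
Qed.

Lemma cvg_marginal2_subpos p j : summable2 p ->
  marginal2 (arr_subpos p e) j @[e --> (0 : R)^'+] --> marginal2 p j.
Proof.
move=> sp.
suff h : \esum_(i in [set: nat]) (arr_subpos p e (i, j))%:E @[e --> (0 : R)^'+]
    --> (marginal2 p j)%:E by have /fine_cvgP[_] := h; exact.
rewrite marginal2E//; apply: cvg_esum_dominated.
- by near=> e => i; rewrite /arr_subpos le_max lexx orbT.
- move=> i; have := cvg_subpos_entry p (i, j).
  by rewrite (max_idPl (sp.1 _)).
- near=> e; apply: le_esum => i _; rewrite lee_fin ge_max sp.1 gerBl andbT.
  by apply: ltW; near: e; exact: nbhs_right_gt.
Unshelve. all: by end_near. Qed.

(** Each term converges and monotonicity of [condH] dominates the totals, so an infinite [condH p]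
    is covered too. *)
Lemma cvg_condH_subpos p : summable2 p ->
  condH (arr_subpos p e) @[e --> (0 : R)^'+] --> condH p.
Proof.
move=> sp; apply: cvg_esum_dominated.
- near=> e => i; apply: ent_ge0; first by rewrite le_max lexx orbT.
  by apply: le_marginal2_entry; apply: summable2_subpos => //; near: e;
    exact: nbhs_right_ge.
(* A zero entry needs its own case, as [ln] is not continuous at zero; its truncation stays zero. A
   positive entry forces a positive column mass. *)
- move=> i; have /predU1P[/esym pi0|pi0] : ((0 == p i) || (0 < p i))%R.
    by rewrite -le_eqVlt sp.1.
    rewrite pi0 mul0r; apply: cvg_near_cst; near=> e.
    rewrite /arr_subpos pi0 (_ : Num.max _ _ = 0%R) ?mul0r//; apply/max_idPr.
    by rewrite sub0r oppr_le0; near: e; exact: nbhs_right_ge.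
  have s0 := lt_le_trans pi0 (le_marginal2_entry p i sp).
  have cp : arr_subpos p e i @[e --> (0 : R)^'+] --> p i.
    by have := cvg_subpos_entry p i; rewrite (max_idPl (sp.1 _)).
  apply: cvgM => //; apply: cvgN; apply: continuous_cvg;
    first by apply: continuous_ln; rewrite divr_gt0.
  by apply: cvgM => //; apply: cvgV;
    [rewrite gt_eqF|exact: cvg_marginal2_subpos].
- near=> e; have e0 : (0 < e)%R by [].
  apply: (condH_le _ _ _ sp) => i;
    rewrite le_max lexx orbT ge_max sp.1 gerBl andbT; exact: ltW.
Unshelve. all: by end_near. Qed.

End arrays.

Theorem proposition6 (R : realType) :
  (forall p : array2 R, distr2 p ->
     (forall eps : R, (0 < eps)%R -> (eps <= 1)%R ->
        hcondH (arr_subpos p eps) - (g eps)%:E <= LcondH p eps) /\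
     (hcondH (arr_subpos p eps) - (g eps)%:E @[eps --> (0 : R)^'+] --> condH p)) /\
  (forall p : array2 R, distr2 p -> condH p < +oo ->
     (forall eps : R, (0 < eps)%R -> (eps <= 1)%R ->
        condH p - hcondH (arr_min p eps) - (g eps)%:E <= LcondH p eps) /\
     (condH p - hcondH (arr_min p eps) - (g eps)%:E @[eps --> (0 : R)^'+]
        --> condH p)).
Proof.
(* Serves both as the limit of (i) and as the lower side of the squeeze for (ii). The limit of [g]
   is finite, so the difference converges even when [condH p] is infinite. *)
have limA (p : array2 R) : distr2 p ->
    hcondH (arr_subpos p e) - (g e)%:E @[e --> (0 : R)^'+] --> condH p.
  move=> /distr2_summable2 sp; rewrite -[X in _ --> X]sube0; apply: cvgeB.
  - by rewrite fin_num_adde_defl.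
  - apply: cvg_trans (cvg_condH_subpos _ sp); apply: near_eq_cvg; near=> e.
    by rewrite hcondHE//; apply: summable2_subpos => //; near: e;
      exact: nbhs_right_ge.
  - by apply: cvg_EFin; [exact: nearW|exact: cvg_g0].
split=> p dp; have sp := distr2_summable2 _ dp.
  split=> [e e0 e1|]; last exact: limA.
  apply: le_ereal_inf_tmp => _ [q [dq pqe] <-].
  rewrite hcondHE; last by apply: summable2_subpos => //; exact: ltW.
  apply: le_trans (condH_subpos_le_TV _ _ _ (ltW e0) dp dq pqe).
  by rewrite leeBlDr// leeDl// lee_fin g_ge0// ltW.
move=> Hoo; have Hfin : condH p \is a fin_num
  by rewrite ge0_fin_numE// condH_ge0.
(* Finiteness allows this entropy to be moved across inequalities in the extended reals. *)
have minfin (e : R) : (0 < e)%R -> condH (arr_min p e) \is a fin_num.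
  move=> e0; rewrite ge0_fin_numE; last by apply: condH_ge0;
    apply: summable2_min => //; exact: ltW.
  apply: le_lt_trans Hoo; apply: (condH_le _ _ _ sp) => i.
  by rewrite le_min ge_min lexx sp.1 ltW.
split=> [e e0 e1|].
  apply: le_ereal_inf_tmp => _ [q [dq pqe] <-].
  rewrite hcondHE; last by apply: summable2_min => //; exact: ltW.
  by rewrite leeBlDr// leeBlDr ?minfin// addeAC condH_min_le_TV.
apply: (squeeze_cvge _ (limA _ dp) (cvg_cst (condH p))).
near=> e; have e0 : (0 < e)%R by [].
have e1 : (e <= 1)%R by near: e; exact: nbhs_right_le.
rewrite !hcondHE;
  [|by apply: summable2_min => //; exact: ltW
   |by apply: summable2_subpos => //; exact: ltW].
apply/andP; split.
  (* Superadditivity for the splitting [arr_subposD] compares the right-hand sides of (i) and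
     (ii). *)
  rewrite leeD2r// leeBrDr ?minfin// -[X in _ <= condH X](arr_subposD p e).
  by apply: condH_superadd; [apply: summable2_subpos|apply: summable2_min] => //;
    exact: ltW.
rewrite leeBlDr// leeBlDr ?minfin// -addeA leeDl// adde_ge0//.
  by rewrite lee_fin g_ge0// ltW.
by apply: condH_ge0; apply: summable2_min => //; exact: ltW.
Unshelve. all: by end_near. Qed.
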